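(* Let $(G,P)$ be a lattice ordered abelian group and $(A,\alpha,P)$ a C*-dynamical system. Then the product dilation $(B,\beta,G)$ is a minimal Nica-covariant automorphic dilation of $(A,\alpha,P)$.
   Context: Lattice ordered abelian group $(G,P)$: a discrete abelian group $G$ (written additively) and a subsemigroup $P\ni 0$ with $P\cap(-P)=\{0\}$, $G=P-P$, such that the partial order $g\le h\iff h-g\in P$ makes $G$ a lattice, with join $\vee$ and meet $\wedge$. C*-dynamical system $(A,\alpha,P)$ over a semigroup $P$ with identity $0$: a C*-algebra $A$ and a semigroup homomorphism $p\mapsto\alpha_p$ into the $\ast$-endomorphisms of $A$ with $\alpha_0=\mathrm{id}$. (For a group $G$ each $\beta_g$ is automatically an automorphism.) Product dilation: let $\iota:A\to\prod_GA$ be $\iota(a)_g=\alpha_g(a)$ if $g\in P$ and $\iota(a)_g=0$ if $g\notin P$ (bounded $G$-tuples); let $G$ act on $\prod_GA$ by $[\beta_g(x)]_h=x_{h+g}$; put $B=C^\ast(\bigcup_{g\in G}\beta_g\iota(A))$ with the restricted action $\beta$ and the embedding $\iota:A\to B$. Automorphic dilation of $(A,\alpha,P)$: a C*-dynamical system $(B,\beta,G)$ with an injective $\ast$-homomorphism $\iota:A\to B$ such that $\iota(a)\beta_p(\iota(b))=\iota(a\alpha_p(b))$ for $a,b\in A$, $p\in P$. It is Nica-covariant if also $\beta_g(\iota(a))\beta_h(\iota(b))=\beta_{g\wedge h}(\iota(\alpha_{g-g\wedge h}(a)\alpha_{h-g\wedge h}(b)))$ for $a,b\in A$, $g,h\in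 G$; minimal if $B=C^\ast(\bigcup_{g\in G}\beta_g\iota(A))$. *)

(* Defs.v *)
From HB Require Import structures.
From mathcomp Require Import all_boot all_order all_algebra.
From mathcomp Require Import complex ring.
From mathcomp Require Import mathcomp_extra boolp classical_sets functions reals.
From mathcomp Require Import topology normedtype sequences.

Set Implicit Arguments.
Unset Strict Implicit.
Unset Printing Implicit Defensive.

Import Order.TTheory GRing.Theory Num.Theory.
Import numFieldNormedType.Exports.

Local Open Scope classical_set_scope.
Local Open Scope ring_scope.
Local Open Scope complex_scope.

(* Complex scalars are R[i] for R : realType; norms take values in R[i]. C*-algebras
   are not assumed unital, hence [cmul] instead of a MathComp ring structure. *)
HB.mixin Record isCStarAlgebra (R : realType) A
    & CompleteNormedModule R[i] A := {
  cmul : A -> A -> A;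
  star : A -> A;
  cmulA : associative cmul;
  cmulDl : left_distributive cmul +%R;
  cmulDr : right_distributive cmul +%R;
  cmulZl : forall (k : R[i]) x y, cmul (k *: x) y = k *: cmul x y;
  cmulZr : forall (k : R[i]) x y, cmul x (k *: y) = k *: cmul x y;
  starK : involutive star;
  starD : {morph star : x y / x + y};
  starZ : forall (k : R[i]) x, star (k *: x) = (k^*)%R *: star x;
  starM : forall x y, star (cmul x y) = cmul (star y) (star x);
  cnormM : forall x y, `|cmul x y| <= `|x| * `|y|;
  cnorm_star : forall x, `|cmul (star x) x| = `|x| ^+ 2
}.

#[short(type="cstarType")]
HB.structure Definition CStarAlgebra (R : realType) :=
  {A of isCStarAlgebra R A & CompleteNormedModule R[i] A}.

Notation "x ** y" := (cmul x y) (at level 40, left associativity) : ring_scope.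

Section Basics.
Context {R : realType} {A : cstarType R}.
Implicit Types x y : A.

Lemma cmul0l x : 0 ** x = 0.
Proof. by have := cmulZl 0 0 x; rewrite !scale0r. Qed.

Lemma cmul0r x : x ** 0 = 0.
Proof. by have := cmulZr 0 x 0; rewrite !scale0r. Qed.

Lemma cmulNl x y : (- x) ** y = - (x ** y).
Proof. by rewrite -scaleN1r cmulZl scaleN1r. Qed.

Lemma cmulNr x y : x ** (- y) = - (x ** y).
Proof. by rewrite -scaleN1r cmulZr scaleN1r. Qed.

Lemma cmulBl x y z : (x - y) ** z = x ** z - y ** z.
Proof. by rewrite cmulDl cmulNl. Qed.

Lemma cmulBr x y z : x ** (y - z) = x ** y - x ** z.
Proof. by rewrite cmulDr cmulNr. Qed.

Lemma star0 : star (0 : A) = 0.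
Proof. by have := starZ 0 (0 : A); rewrite conjC0 !scale0r. Qed.

Lemma starN x : star (- x) = - star x.
Proof. by rewrite -scaleN1r starZ rmorphN rmorph1 scaleN1r. Qed.

Lemma starB x y : star (x - y) = star x - star y.
Proof. by rewrite starD starN. Qed.

Lemma norm_star x : `|star x| = `|x|.
Proof.
have H (y : A) : `|y| <= `|star y|.
  have [->|y0] := eqVneq y 0; first by rewrite star0.
  have y1 : 0 < `|y| by rewrite normr_gt0.
  by rewrite -(ler_pM2r y1) -expr2 -cnorm_star cnormM.
by apply/le_anti; rewrite H -{2}(starK x) H.
Qed.

End Basics.

Lemma nonexpansive_continuous (K : numFieldType) (V W : normedModType K)
    (f : V -> W) :
  (forall x y, `|f x - f y| <= `|x - y|) -> continuous f.
Proof.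
move=> f1 x; apply/cvgrPdist_lt => e e0; near=> y.
apply: (le_lt_trans (f1 _ _)); near: y.
by apply/nbhs_ballP; exists e => // y; rewrite -ball_normE.
Unshelve. all: by end_near. Qed.

Definition star_hom (R : realType) (A B : cstarType R) (f : A -> B) :=
  [/\ forall (k : R[i]) x y, f (k *: x + y) = k *: f x + f y,
      forall x y, f (x ** y) = f x ** f y
    & forall x, f (star x) = star (f x)].

(* The full product of copies of A indexed by I: bounded tuples with pointwise
   operations and the supremum norm. *)
Section Linf.
Context (R : realType) (I : Type) (A : cstarType R).

Definition bounded_tuple : {pred I -> A} :=
  fun f => `[< exists M, forall i, `|f i| <= M >].

Lemma bounded_tupleP f :
  reflect (exists M, forall i, `|f i| <= M) (f \in bounded_tuple).
Proof. exact: asboolP. Qed.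

Fact bounded_tuple_submod : submod_closed bounded_tuple.
Proof.
split=> [|k f g /bounded_tupleP[M fM] /bounded_tupleP[N gN]].
  by apply/bounded_tupleP; exists 0 => i; rewrite normr0.
apply/bounded_tupleP; exists (`|k| * M + N) => i.
rewrite (le_trans (ler_normD _ _))// lerD//.
by rewrite normrZ ler_wpM2l.
Qed.

HB.instance Definition _ :=
  GRing.isSubmodClosed.Build R[i] (I -> A) bounded_tuple bounded_tuple_submod.

Record linf := Linf { linf_fun :> I -> A; _ : linf_fun \in bounded_tuple }.

HB.instance Definition _ := [isSub for linf_fun].
HB.instance Definition _ := [Choice of linf by <:].
HB.instance Definition _ := [SubChoice_isSubLmodule of linf by <:].

Implicit Types x y : linf.

Definition linf_norm x : R[i] := (sup (range (fun i => complex.Re `|x i|)))%:C.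

Lemma linfP x : exists M, forall i, `|x i| <= M.
Proof. by case: x => f /= /bounded_tupleP. Qed.


Lemma linfE x y : (forall i, x i = y i) -> x = y.
Proof. by move=> xy; apply/val_inj/funext. Qed.

Lemma linfD x y i : (x + y) i = x i + y i. Proof. by []. Qed.
Lemma linfN x i : (- x) i = - x i. Proof. by []. Qed.
Lemma linfZ (k : R[i]) x i : (k *: x) i = k *: x i. Proof. by []. Qed.
Lemma linf0 i : (0 : linf) i = 0. Proof. by []. Qed.

Lemma ReK (z : R[i]) : 0 <= z -> (complex.Re z)%:C = z.
Proof. by move=> z0; rewrite RRe_real// ger0_real. Qed.

Lemma linf_norm_ub x i : `|x i| <= linf_norm x.
Proof.
rewrite -(ReK (normr_ge0 (x i))) lecR; apply: ub_le_sup; last by exists i.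
have [M xM] := linfP x; exists (complex.Re M) => _ [j _ <-].
by have := xM j; rewrite lecE => /andP[].
Qed.

Lemma linf_norm_le x (M : R[i]) : 0 <= M -> (forall i, `|x i| <= M) ->
  linf_norm x <= M.
Proof.
move=> M0 xM; rewrite -(ReK M0) lecR.
have [->|/set0P ne] := eqVneq (range (fun i => complex.Re `|x i|)) set0.
  by rewrite sup0; move: M0; rewrite lecE => /andP[].
apply: ge_sup => // _ [i _ <-].
by have := xM i; rewrite lecE => /andP[].
Qed.

Lemma linf_norm_ge0 x : 0 <= linf_norm x.
Proof.
rewrite lecR; have [i|] := pselect (inhabited I).
  case: i => i; have := le_trans (normr_ge0 _) (linf_norm_ub x i).
  by rewrite lecR.
move=> nI; have -> : range (fun i => complex.Re `|x i|) = set0; last by rewrite sup0.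
by apply/seteqP; split=> // r [i _ _]; case: nI; exists.
Qed.

Lemma linf_normD x y : linf_norm (x + y) <= linf_norm x + linf_norm y.
Proof.
apply: linf_norm_le => [|i]; first by rewrite addr_ge0// linf_norm_ge0.
by rewrite linfD (le_trans (ler_normD _ _))// lerD// linf_norm_ub.
Qed.

Lemma linf_normZ (k : R[i]) x : linf_norm (k *: x) = `|k| * linf_norm x.
Proof.
apply/le_anti/andP; split.
  apply: linf_norm_le => [|i]; first by rewrite mulr_ge0// linf_norm_ge0.
  by rewrite linfZ normrZ ler_wpM2l// linf_norm_ub.
have [->|k0] := eqVneq k 0; first by rewrite normr0 mul0r linf_norm_ge0.
have k1 : 0 < `|k| by rewrite normr_gt0.
rewrite -ler_pdivlMl//; apply: linf_norm_le => [|i].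
  by rewrite mulr_ge0 ?invr_ge0 ?linf_norm_ge0.
by rewrite ler_pdivlMl// -normrZ -linfZ linf_norm_ub.
Qed.

Lemma linf_norm0_eq0 x : linf_norm x = 0 -> x = 0.
Proof.
move=> x0; apply: linfE => i; apply/eqP; rewrite -normr_eq0 eq_le normr_ge0.
by rewrite -x0 linf_norm_ub.
Qed.

HB.instance Definition _ := Lmodule_isNormed.Build R[i] linf
  linf_normD linf_normZ linf_norm0_eq0.

Lemma linf_normE x : `|x| = linf_norm x. Proof. by []. Qed.

Lemma linf_complete (F : set_system linf) : ProperFilter F -> cauchy F -> cvg F.
Proof.
move=> FF /cauchyP Fc.
have ev i : cauchy ((fun x : linf => x i) @ F).
  apply: cauchy_exP => e e0; have [x Fx] := Fc _ e0; exists (x i).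
  rewrite /fmap /=; apply: filterS Fx => y; rewrite -!ball_normE/= => xy.
  exact: le_lt_trans (linf_norm_ub (x - y) i) xy.
have ev_cvg i : exists l : A, (fun x : linf => x i) @ F --> l.
  by exists (lim ((fun x : linf => x i) @ F)); exact: cauchy_cvg (ev i).
have [l Fl] := choice ev_cvg.
have lP e : 0 < e -> exists2 x : linf, F (ball x e) & forall i, `|x i - l i| <= e.
  move=> e0; have [x Fx] := Fc _ e0; exists x => // i.
  apply/ler_addgt0Pr => d d0.
  have /cvgrPdist_lt/(_ _ d0) Fd := Fl i.
  near F => y.
  rewrite -(subrKA (y i)) (le_trans (ler_normD _ _))// lerD//; last first.
    by rewrite distrC ltW//; near: y.
  rewrite (le_trans (linf_norm_ub (x - y) i))// ltW//.
  by near: y; apply: filterS Fx => y; rewrite -ball_normE.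
have lb : l \in bounded_tuple.
  have [x _ xl] := lP 1 ltr01; have [M xM] := linfP x.
  apply/bounded_tupleP; exists (1 + M) => i.
  by rewrite -(subrK (x i) (l i)) (le_trans (ler_normD _ _))// lerD// distrC.
suff Fl2 : F --> (Linf lb : linf) by apply: cvgP Fl2.
apply/cvgrPdist_lt => e e0.
have e2 : 0 < e / 2 / 2 by rewrite !divr_gt0.
have [x Fx xl] := lP _ e2.
apply: filterS Fx => y; rewrite -ball_normE/= => xy.
rewrite -(subrKA x) (le_lt_trans (ler_normD _ _))//.
rewrite [ltRHS]splitr ler_ltD//; last first.
  by rewrite (lt_trans xy)// ltr_pdivrMr// ltr_pMr ?divr_gt0// ltr1n.
rewrite distrC (@le_trans _ _ (e / 2 / 2))//; last first.
  by rewrite ltW// ltr_pdivrMr// ltr_pMr ?divr_gt0// ltr1n.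
apply: linf_norm_le; first exact: ltW.
by move=> i; exact: xl.
Unshelve. all: by end_near. Qed.

HB.instance Definition _ := Uniform_isComplete.Build linf linf_complete.

Fact linf_mul_subproof x y : (fun i => x i ** y i) \in bounded_tuple.
Proof.
apply/bounded_tupleP; exists (`|x| * `|y|) => i.
rewrite (le_trans (cnormM _ _))// ler_pM// linf_norm_ub//.
Qed.

Fact linf_star_subproof x : (fun i => star (x i)) \in bounded_tuple.
Proof.
by apply/bounded_tupleP; exists `|x| => i; rewrite norm_star linf_norm_ub.
Qed.

Definition linf_mul x y := Linf (linf_mul_subproof x y).
Definition linf_star x := Linf (linf_star_subproof x).

Fact linf_normM x y : `|linf_mul x y| <= `|x| * `|y|.
Proof.
apply: linf_norm_le => [|i]; first by rewrite mulr_ge0.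
by rewrite (le_trans (cnormM _ _))// ler_pM// linf_norm_ub.
Qed.

Fact linf_norm_star x : `|linf_mul (linf_star x) x| = `|x| ^+ 2.
Proof.
have nx : 0 <= `|linf_mul (linf_star x) x| by [].
apply/le_anti/andP; split.
  apply: linf_norm_le => [|i]; first by rewrite exprn_ge0.
  by rewrite /= cnorm_star lerXn2r ?nnegrE ?linf_norm_ub.
rewrite -[leRHS]sqrtCK lerXn2r ?nnegrE ?sqrtC_ge0//.
apply: linf_norm_le => [|i]; first by rewrite sqrtC_ge0.
rewrite -(@ler_pXn2r _ 2)// ?nnegrE ?sqrtC_ge0// sqrtCK -cnorm_star.
exact: linf_norm_ub (linf_mul (linf_star x) x) i.
Qed.

Let linf_mulA : associative linf_mul.
Proof. by move=> x y z; apply: linfE => i; exact: cmulA. Qed.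

Let linf_mulDl : left_distributive linf_mul +%R.
Proof. by move=> x y z; apply: linfE => i; exact: cmulDl. Qed.

Let linf_mulDr : right_distributive linf_mul +%R.
Proof. by move=> x y z; apply: linfE => i; exact: cmulDr. Qed.

Let linf_mulZl (k : R[i]) x y : linf_mul (k *: x) y = k *: linf_mul x y.
Proof. by apply: linfE => i; exact: cmulZl. Qed.

Let linf_mulZr (k : R[i]) x y : linf_mul x (k *: y) = k *: linf_mul x y.
Proof. by apply: linfE => i; exact: cmulZr. Qed.

Let linf_starK : involutive linf_star.
Proof. by move=> x; apply: linfE => i; exact: starK. Qed.

Let linf_starD : {morph linf_star : x y / x + y}.
Proof. by move=> x y; apply: linfE => i; exact: starD. Qed.

Let linf_starZ (k : R[i]) x : linf_star (k *: x) = (k^*)%R *: linf_star x.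
Proof. by apply: linfE => i; exact: starZ. Qed.

Let linf_starM x y : linf_star (linf_mul x y) = linf_mul (linf_star y) (linf_star x).
Proof. by apply: linfE => i; exact: starM. Qed.

HB.instance Definition _ := isCStarAlgebra.Build R linf
  linf_mulA linf_mulDl linf_mulDr linf_mulZl linf_mulZr
  linf_starK linf_starD linf_starZ linf_starM linf_normM linf_norm_star.

End Linf.

Definition cstar_subalgebra (R : realType) (A : cstarType R) (D : set A) :=
  [/\ D 0,
      forall (k : R[i]) x y, D x -> D y -> D (k *: x + y),
      forall x y, D x -> D y -> D (x ** y),
      forall x, D x -> D (star x)
    & closed D].

(* C^*(S) *)
Definition cstar_gen (R : realType) (A : cstarType R) (S : set A) : set A :=
  smallest (@cstar_subalgebra R A) S.

Lemma cstar_gen_subalgebra (R : realType) (A : cstarType R) (S : set A) :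
  cstar_subalgebra (cstar_gen S).
Proof.
split.
- by move=> D [[]].
- move=> k x y Sx Sy D DS; have [[_ Dl _ _ _] _] := DS.
  exact: Dl (Sx _ DS) (Sy _ DS).
- move=> x y Sx Sy D DS; have [[_ _ DM _ _] _] := DS.
  exact: DM (Sx _ DS) (Sy _ DS).
- by move=> x Sx D DS; have [[_ _ _ Dst _] _] := DS; exact: Dst (Sx _ DS).
- by apply: closed_bigI => D [[_ _ _ _ cD] _]; exact: cD.
Qed.

Record cstarSub (R : realType) (A : cstarType R) := CStarSub {
  cstarSub_set :> set A;
  cstarSubP : cstar_subalgebra cstarSub_set
}.

Definition cstar_gen_sub (R : realType) (A : cstarType R) (S : set A) :=
  CStarSub (cstar_gen_subalgebra S).

Section SubCStar.
Context (R : realType) (A : cstarType R) (D : cstarSub A).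

Definition cstarSub_pred : {pred A} := fun x => `[< cstarSub_set D x >].

Lemma cstarSub_predP x : reflect (cstarSub_set D x) (x \in cstarSub_pred).
Proof. exact: asboolP. Qed.

Fact cstarSub_submod : submod_closed cstarSub_pred.
Proof.
have [D0 Dl _ _ _] := cstarSubP D.
split=> [|k x y /cstarSub_predP Dx /cstarSub_predP Dy]; apply/cstarSub_predP => //.
exact: Dl.
Qed.

HB.instance Definition _ :=
  GRing.isSubmodClosed.Build R[i] A cstarSub_pred cstarSub_submod.

Record cstar_sub := CStarSubElt {
  cstar_val :> A;
  _ : cstar_val \in cstarSub_pred
}.

HB.instance Definition _ := [isSub for cstar_val].
HB.instance Definition _ := [Choice of cstar_sub by <:].
HB.instance Definition _ := [SubChoice_isSubLmodule of cstar_sub by <:].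

Implicit Types x y : cstar_sub.

Lemma cstar_subP x : cstarSub_set D x.
Proof. by case: x => x /= /cstarSub_predP. Qed.

Definition CStarSubIn (x : A) (Dx : cstarSub_set D x) : cstar_sub :=
  CStarSubElt (introT (cstarSub_predP x) Dx).

Let nrm x : R[i] := `|cstar_val x|.

Let nrmD x y : nrm (x + y) <= nrm x + nrm y.
Proof. exact: ler_normD. Qed.

Let nrmZ (k : R[i]) x : nrm (k *: x) = `|k| * nrm x.
Proof. exact: normrZ. Qed.

Let nrm0_eq0 x : nrm x = 0 -> x = 0.
Proof. by move=> /normr0_eq0 x0; apply: val_inj. Qed.

HB.instance Definition _ := Lmodule_isNormed.Build R[i] cstar_sub
  nrmD nrmZ nrm0_eq0.

Let sub_complete (F : set_system cstar_sub) : ProperFilter F -> cauchy F -> cvg F.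
Proof.
move=> FF /cauchyP Fc.
have vc : cauchy (cstar_val @ F).
  apply: cauchy_exP => e e0; have [x Fx] := Fc _ e0; exists (x : A).
  by rewrite /fmap /=; apply: filterS Fx => y; rewrite -!ball_normE.
have [l Fl] : exists l : A, cstar_val @ F --> l.
  by exists (lim (cstar_val @ F)); exact: cauchy_cvg vc.
have [_ _ _ _ cD] := cstarSubP D.
have Dl : cstarSub_set D l.
  apply: (closed_cvg (u_ := cstar_val) _ cD _ _ Fl); apply: nearW => x.
  exact: cstar_subP.
suff Fl2 : F --> CStarSubIn Dl by apply: cvgP Fl2.
apply/cvgrPdist_lt => e e0.
by move/cvgrPdist_lt : Fl => /(_ _ e0).
Qed.

HB.instance Definition _ := Uniform_isComplete.Build cstar_sub sub_complete.

Fact cstar_sub_mul_subproof x y : cstarSub_set D (cstar_val x ** cstar_val y).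
Proof. by have [_ _ DM _ _] := cstarSubP D; apply: DM; exact: cstar_subP. Qed.

Fact cstar_sub_star_subproof x : cstarSub_set D (star (cstar_val x)).
Proof. by have [_ _ _ Dst _] := cstarSubP D; apply: Dst; exact: cstar_subP. Qed.

Definition cstar_sub_mul x y := CStarSubIn (cstar_sub_mul_subproof x y).
Definition cstar_sub_star x := CStarSubIn (cstar_sub_star_subproof x).

Let sub_mulA : associative cstar_sub_mul.
Proof. by move=> x y z; apply: val_inj; exact: cmulA. Qed.

Let sub_mulDl : left_distributive cstar_sub_mul +%R.
Proof. by move=> x y z; apply: val_inj; exact: cmulDl. Qed.

Let sub_mulDr : right_distributive cstar_sub_mul +%R.
Proof. by move=> x y z; apply: val_inj; exact: cmulDr. Qed.

Let sub_mulZl (k : R[i]) x y : cstar_sub_mul (k *: x) y = k *: cstar_sub_mul x y.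
Proof. by apply: val_inj; exact: cmulZl. Qed.

Let sub_mulZr (k : R[i]) x y : cstar_sub_mul x (k *: y) = k *: cstar_sub_mul x y.
Proof. by apply: val_inj; exact: cmulZr. Qed.

Let sub_starK : involutive cstar_sub_star.
Proof. by move=> x; apply: val_inj; exact: starK. Qed.

Let sub_starD : {morph cstar_sub_star : x y / x + y}.
Proof. by move=> x y; apply: val_inj; exact: starD. Qed.

Let sub_starZ (k : R[i]) x : cstar_sub_star (k *: x) = (k^*)%R *: cstar_sub_star x.
Proof. by apply: val_inj; exact: starZ. Qed.

Let sub_starM x y :
  cstar_sub_star (cstar_sub_mul x y) =
  cstar_sub_mul (cstar_sub_star y) (cstar_sub_star x).
Proof. by apply: val_inj; exact: starM. Qed.

Let sub_normM x y : `|cstar_sub_mul x y| <= `|x| * `|y|.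
Proof. exact: cnormM. Qed.

Let sub_norm_star x : `|cstar_sub_mul (cstar_sub_star x) x| = `|x| ^+ 2.
Proof. exact: cnorm_star. Qed.

HB.instance Definition _ := isCStarAlgebra.Build R cstar_sub
  sub_mulA sub_mulDl sub_mulDr sub_mulZl sub_mulZr
  sub_starK sub_starD sub_starZ sub_starM sub_normM sub_norm_star.

End SubCStar.

(* Automatic contractivity of *-homomorphisms, [star_hom_le] below, is what makes
   the tuples (alpha_g(a))_g of the product dilation bounded. It is proved without
   functional calculus: a self-adjoint u of norm 1 is shown not to have a
   quasi-inverse of u^2, whereas any x with `|x| < 1 has a quasi-inverse. *)
Section QuasiInverse.
Context (R : realType) (A : cstarType R).

Lemma geometric_small (q e : R[i]) : 0 <= q -> q < 1 -> 0 < e ->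
  exists N, forall n, (N <= n)%N -> q ^+ n < e.
Proof.
move=> q0 q1 e0; have /ReK qE := q0; have /ReK eE := ltW e0.
move: q0 q1 e0; rewrite -qE -eE lecR -[1]/(1%:C) !ltcR => q0 q1 e0.
have := @cvg_geometric R 1 (complex.Re q).
rewrite ger0_norm// => /(_ q1)/cvgrPdist_lt/(_ _ e0)[N _ H]; exists N => n /H/=.
by rewrite sub0r normrN mul1r ger0_norm ?exprn_ge0// -rmorphXn ltcR.
Qed.

Lemma quasi_inverse (x : A) : `|x| < 1 -> exists g : A, g ** x = g + x.
Proof.
move=> x1; pose f (y : A) := y ** x - x; pose S n := iter n f 0.
have f_dist y z : `|f y - f z| <= `|x| * `|y - z|.
  by rewrite /f opprB addrA subrK -cmulBl mulrC cnormM.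
have x1' : 0 < 1 - `|x| by rewrite subr_gt0.
have S_bnd n : `|S n| <= (1 - `|x|)^-1.
  elim: n => [|n ih]; first by rewrite normr0 invr_ge0 ltW.
  rewrite (le_trans (ler_normB _ _))//.
  rewrite (le_trans (lerD (le_trans (cnormM _ _)
    (ler_wpM2r (normr_ge0 x) ih)) (lexx _)))//.
  have /(canRL (subrK _)) {2}-> : (1 - `|x|)^-1 - (1 - `|x|)^-1 * `|x| = 1.
    by rewrite -{1}[(1 - `|x|)^-1]mulr1 -mulrBr mulVf// gt_eqF.
  by rewrite addrC lerD2r ltW.
have S_dist n m : `|S (n + m)%N - S n| <= `|x| ^+ n * (1 - `|x|)^-1.
  elim: n => [|n ih]; first by rewrite expr0 mul1r subr0.
  by rewrite exprS -mulrA (le_trans (f_dist _ _))// ler_wpM2l.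
have Sc : cauchy (S @ \oo).
  apply: cauchy_exP => e e0.
  have [N HN] := geometric_small (normr_ge0 x) x1 (mulr_gt0 e0 x1').
  exists (S N); exists N => // n /= Nn; rewrite -ball_normE/= distrC.
  rewrite -(subnKC Nn) (le_lt_trans (S_dist _ _))// ltr_pdivrMr//.
  exact: HN.
have [g Sg] : exists g : A, S @ \oo --> g.
  by exists (lim (S @ \oo)); exact: cauchy_cvg Sc.
exists g; suff : g - f g = 0.
  by move/eqP; rewrite subr_eq0 => /eqP {2}->; rewrite subrK.
apply/eqP; rewrite -normr_eq0 eq_le normr_ge0 andbT.
apply/ler_addgt0Pr => e e0; rewrite add0r.
have e2 : 0 < e / 2 by rewrite divr_gt0.
move/cvgrPdist_lt : Sg => /(_ _ e2)[N _ HN].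
rewrite [e]splitr -(subrKA (S N.+1)) (le_trans (ler_normD _ _))// lerD//.
  by rewrite ltW// HN//= leqnSn.
rewrite (le_trans (f_dist _ _))// distrC (le_trans (ler_piMl _ (ltW x1)))//.
by rewrite ltW// HN/=.
Qed.

End QuasiInverse.

Section Poly.
Context (R : realType) (A : cstarType R) (u : A).
Implicit Types p q : {poly R}.

Fixpoint cpow n : A := if n is n'.+1 then u ** cpow n' else u.

(* the value at u of the polynomial p(X) X, which has no constant term *)
Definition ev p : A := \sum_(i < size p) (p`_i)%:C *: cpow i.

Lemma evE p n : (size p <= n)%N -> ev p = \sum_(i < n) (p`_i)%:C *: cpow i.
Proof.
move=> pn; rewrite /ev (big_ord_widen _ (fun i => (p`_i)%:C *: cpow i) pn).
rewrite big_mkcond; apply: eq_bigr => i _; case: ltnP => // pi.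
by rewrite nth_default// scale0r.
Qed.

Lemma evD p q : ev (p + q) = ev p + ev q.
Proof.
pose n := maxn (size p) (size q).
rewrite (@evE p n) ?leq_maxl// (@evE q n) ?leq_maxr//.
rewrite (@evE _ n) ?(leq_trans (size_polyD _ _))// -big_split/=.
by apply: eq_bigr => i _; rewrite coefD rmorphD scalerDl.
Qed.

Lemma evZ c p : ev (c *: p) = c%:C *: ev p.
Proof.
rewrite (@evE _ (size p)) ?size_scale_leq// scaler_sumr.
by apply: eq_bigr => i _; rewrite coefZ rmorphM scalerA.
Qed.

Lemma evB p q : ev (p - q) = ev p - ev q.
Proof. by rewrite -scaleN1r evD evZ rmorphN1 scaleN1r. Qed.

Lemma ev0 : ev 0 = 0. Proof. by rewrite /ev size_poly0 big_ord0. Qed.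

Lemma ev1 : ev 1 = u.
Proof. by rewrite /ev size_poly1 big_ord1 coefC/= scale1r. Qed.

Lemma evX p : ev (p * 'X) = u ** ev p.
Proof.
rewrite (@evE _ (size p).+1); last first.
  by rewrite (leq_trans (size_polyMleq _ _))// size_polyX addn2.
rewrite big_ord_recl coefMX/= scale0r add0r.
rewrite /ev (big_morph (cmul u) (cmulDr u) (cmul0r u)).
by apply: eq_bigr => i _; rewrite coefMX/= cmulZr.
Qed.

Lemma evM p q : ev p ** ev q = ev (p * q * 'X).
Proof.
elim/poly_ind: p => [|p c ih]; first by rewrite !mul0r ev0 cmul0l.
rewrite !(evD, mulrDl) evX cmulDl -cmulA ih -evX; congr (_ + _).
  by congr ev; ring.
by rewrite -alg_polyC evZ ev1 cmulZl -!scalerAl !evZ mul1r evX.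
Qed.

Hypotheses (us : star u = u) (u1 : `|u| = 1).

Lemma ev_star p : star (ev p) = ev p.
Proof.
elim/poly_ind: p => [|p c ih]; first by rewrite ev0 star0.
rewrite evD evX starD starM ih us -alg_polyC evZ ev1 starZ us; congr (_ + _).
  by rewrite -ev1 !evM mulr1 mul1r.
by rewrite conj_Creal// complex_real.
Qed.

Lemma ev_norm2 p : `|ev p| ^+ 2 = `|ev (p * p * 'X)|.
Proof. by rewrite -cnorm_star ev_star evM. Qed.

Lemma ev_arens p q : `|ev p| ^+ 2 <= `|ev ((p * p + q * q) * 'X)|.
Proof.
pose v := ev p + 'i%R *: ev q.
have ii : 'i%R * 'i%R = -1 :> R[i] by rewrite -expr2 sqrCi.
have vs : star v = ev p - 'i%R *: ev q.
  by rewrite starD starZ !ev_star conjCi scaleNr.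
have vv : star v ** v = ev ((p * p + q * q) * 'X).
  rewrite vs cmulBl !cmulDr !cmulZl !cmulZr !evM scalerA ii scaleN1r.
  by rewrite mulrDl evD [q * p]mulrC opprD addrA addrK opprK.
rewrite -vv cnorm_star lerXn2r ?nnegrE//.
have -> : ev p = 2^-1 *: (v + star v).
  rewrite vs addrACA subrr addr0 -mulr2n -[ev p *+ 2]scaler_nat scalerA.
  rewrite mulVf ?scale1r//.
  by rewrite pnatr_eq0.
rewrite normrZ (le_trans (ler_wpM2l (normr_ge0 _) (ler_normD _ _)))//.
rewrite norm_star -mulr2n -[`|v| *+ _]mulr_natl mulrA ger0_norm ?invr_ge0//.
by rewrite mulVf ?mul1r// pnatr_eq0.
Qed.

Lemma ev_arens2 p n :
  `|ev (p * 'X^n)| <= `|ev (2^-1 *: ((1 + 'X^(n.*2)) * p))|.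
Proof.
rewrite -(@ler_pXn2r _ 2)// ?nnegrE// [leRHS]ev_norm2.
rewrite (le_trans (ev_arens _ (2^-1 *: ((1 - 'X^(n.*2)) * p))))//.
rewrite le_eqVlt; apply/orP; left; apply/eqP; congr (`|ev (_ * 'X)|).
rewrite -addnn exprD -!mul_polyC.
have : (2^-1)%:P * (2%:R)%:P = 1 :> {poly R}.
  by rewrite -polyCM mulVf// pnatr_eq0.
rewrite polyCMn polyC1; move: (2^-1)%:P ('X^n) => h t h2.
rewrite -[p * t * _]mul1r -[1 in LHS]mul1r -{1 2}h2; ring.
Qed.

Lemma ev_normXn n : `|ev 'X^n| = 1.
Proof.
have N0 : `|ev 'X^0| = 1 by rewrite expr0 ev1.
have NM m k : `|ev 'X^((m + k).+1)| <= `|ev 'X^m| * `|ev 'X^k|.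
  by rewrite (le_trans _ (cnormM _ _))// evM -exprD -exprSr.
have Nle m : `|ev 'X^m| <= 1.
  elim: m => [|m ih]; first by rewrite N0.
  by have := NM m 0%N; rewrite addn0 N0 mulr1 => /le_trans; exact.
have N2 k : `|ev 'X^((2 ^ k).-1)| = 1.
  elim: k => [|k ih]; first by rewrite N0.
  have := ev_norm2 'X^((2 ^ k).-1); rewrite ih expr1n -exprD -exprSr => ->.
  by rewrite expnS mul2n -addnn -(prednK (expn_gt0 2 k)) addSn /= addnS.
apply/le_anti; rewrite Nle /= -(N2 n.+1).
have -> : ((2 ^ n.+1).-1 = (n + ((2 ^ n.+1).-2 - n)).+1)%N.
  have := ltn_expl n (isT : (1 < 2)%N); rewrite expnS mul2n -addnn.
  case: (2 ^ n)%N => // k nk.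
  by rewrite addSn addnS /= subnKC// (@leq_trans k)// leq_addr.
by rewrite (le_trans (NM _ _))// ler_piMr.
Qed.

Fixpoint cesaro k : {poly R} :=
  if k is k'.+1 then 2^-1 *: ((1 + 'X^(2 ^ k)) * cesaro k') else 1.

Lemma ev_cesaro_ge1 k n : 1 <= `|ev (cesaro k * 'X^n)|.
Proof.
elim: k n => [|k ih] n; first by rewrite mul1r ev_normXn.
have -> : cesaro k.+1 * 'X^n =
    2^-1 *: ((1 + 'X^((2 ^ k).*2)) * (cesaro k * 'X^n)).
  by rewrite /cesaro -/cesaro expnS mul2n -scalerAl -mulrA.
by rewrite (le_trans _ (ev_arens2 _ _))// -mulrA -exprD ih.
Qed.

Lemma cesaroE k :
  cesaro k * (1 - 'X^2) = (2^-1) ^+ k *: (1 - 'X^(2 ^ k.+1)).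
Proof.
elim: k => [|k ih]; first by rewrite expr0 scale1r mul1r.
rewrite /cesaro -/cesaro -scalerAl -mulrA ih -scalerAr scalerA -exprS.
congr (_ *: _); rewrite [(2 ^ k.+2)%N]expnSr exprM; ring.
Qed.

Lemma sa_no_quasi_inverse (g : A) : g ** (u ** u) = g + u ** u -> False.
Proof.
move=> gE.
have bnd k : 1 <= (1 + `|g|) * (2^-1 ^+ k * 2).
  pose w := ev (cesaro k); pose d := w - (u ** u) ** w.
  have wE : w = d - g ** d.
    rewrite /d cmulBr [g ** (_ ** w)]cmulA gE cmulDl opprB.
    by rewrite [g ** w + _]addrC addrK subrK.
  have w1 : 1 <= `|w| by have := ev_cesaro_ge1 k 0; rewrite expr0 mulr1.
  have d1 : `|d| <= 2^-1 ^+ k * 2.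
    have -> : d = ev (cesaro k * (1 - 'X^2)).
      by rewrite /d -cmulA -!evX -evB; congr ev; ring.
    rewrite cesaroE evZ evB normrZ rmorphXn/= fmorphV rmorph_nat.
    rewrite normrX ger0_norm ?invr_ge0// ler_wpM2l ?exprn_ge0 ?invr_ge0//.
    by rewrite (le_trans (ler_normB _ _))// -(expr0 'X) !ev_normXn.
  rewrite (le_trans w1)// wE (le_trans (ler_normB _ _))//.
  rewrite (le_trans (lerD (lexx _) (cnormM _ _)))//.
  by rewrite -[X in X + _ <= _]mul1r -mulrDl ler_wpM2l// addr_ge0.
have gp : 0 < 1 + `|g| by rewrite ltr_pwDl.
have h0 : 0 <= 2^-1 :> R[i] by rewrite invr_ge0.
have h1 : 2^-1 < 1 :> R[i] by rewrite invf_lt1 ?ltr1n.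
have e0 : 0 < (1 + `|g|)^-1 / 2 by rewrite divr_gt0 ?invr_gt0.
have [N /(_ _ (leqnn N)) HN] := geometric_small h0 h1 e0.
have := bnd N; rewrite -ler_pdivrMl// mulr1 -ler_pdivrMr// => H.
by have := le_lt_trans H HN; rewrite ltxx.
Qed.

End Poly.

Lemma star_hom_le (R : realType) (A B : cstarType R) (f : A -> B) (x : A) :
  star_hom f -> `|f x| <= `|x|.
Proof.
move=> [fl fM fs].
have f0 : f 0 = 0 by have := fl (-1) 0 0; rewrite scaler0 addr0 scaleN1r addNr.
have fD a b : f (a + b) = f a + f b by have := fl 1 a b; rewrite !scale1r.
have fZ k a : f (k *: a) = k *: f a by have := fl k a 0; rewrite f0 !addr0.
have [//|lt_fx] := real_leP (normr_real (f x)) (normr_real x).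
exfalso; pose h := star x ** x.
have fh : `|f h| = `|f x| ^+ 2 by rewrite fM fs cnorm_star.
have hlt : `|h| < `|f h| by rewrite fh cnorm_star ltrXn2r.
have fh0 : 0 < `|f h| by apply: le_lt_trans hlt.
pose y := `|f h|^-1 *: h.
have fy : f y = `|f h|^-1 *: f h by exact: fZ.
have ys : star (f y) = f y.
  rewrite fy starZ -fs starM starK conj_Creal// realV; exact: normr_real.
have fy1 : `|f y| = 1.
  by rewrite fy normrZ ger0_norm ?invr_ge0// mulVf// gt_eqF.
have y1 : `|y| < 1.
  by rewrite normrZ ger0_norm ?invr_ge0// mulrC ltr_pdivrMr// mul1r.
have yy1 : `|y ** y| < 1.
  by rewrite (le_lt_trans (cnormM _ _))// mulr_ilt1.
have [g gy] := quasi_inverse yy1.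
apply: (@sa_no_quasi_inverse _ _ (f y) ys fy1 (f g)).
by rewrite -!fM gy fD.
Qed.

Section Dynamics.
Context (R : realType) (G : zmodType).

Definition cone_le (P : set G) (g h : G) := P (h - g).

(* [join] and [meet] are determined by P since the order is antisymmetric. *)
Record lattice_ordered_group (P : set G) (join meet : G -> G -> G) : Prop := {
  cone0 : P 0;
  coneD : forall g h, P g -> P h -> P (g + h);
  cone_pointed : forall g, P g -> P (- g) -> g = 0;
  cone_generating : forall g, exists p q, [/\ P p, P q & g = p - q];
  cone_join : forall g h,
    [/\ cone_le P g (join g h), cone_le P h (join g h)
      & forall k, cone_le P g k -> cone_le P h k -> cone_le P (join g h) k];
  cone_meet : forall g h,
    [/\ cone_le P (meet g h) g, cone_le P (meet g h) h
      & forall k, cone_le P k g -> cone_le P k h -> cone_le P k (meet g h)]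
}.

(* Only the values of alpha on P matter; a system over the group G is a
   [dynamical_system [set: G]]. *)
Definition dynamical_system (A : cstarType R) (P : set G)
    (alpha : G -> A -> A) :=
  [/\ forall p, P p -> star_hom (alpha p),
      forall a, alpha 0 a = a
    & forall p q, P p -> P q -> forall a, alpha (p + q) a = alpha p (alpha q a)].

Section Dilation.
Context (A : cstarType R) (P : set G) (alpha : G -> A -> A).
Context (B : cstarType R) (beta : G -> B -> B) (iota : A -> B).

Definition automorphic_dilation :=
  [/\ dynamical_system [set: G] beta,
      star_hom iota,
      injective iota
    & forall a b p, P p -> iota a ** beta p (iota b) = iota (a ** alpha p b)].

Definition nica_covariant (meet : G -> G -> G) :=
  forall a b g h, beta g (iota a) ** beta h (iota b) =
    beta (meet g h) (iota (alpha (g - meet g h) a ** alpha (h - meet g h) b)).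

Definition minimal_dilation :=
  [set: B] = cstar_gen (\bigcup_g (beta g @` range iota)).

End Dilation.

Section ProductDilation.
Context (A : cstarType R) (P : set G) (alpha : G -> A -> A).
Hypothesis sys : dynamical_system P alpha.

Fact tuple_iota_bounded a :
  (fun g => if g \in P then alpha g a else 0) \in @bounded_tuple R G A.
Proof.
apply/bounded_tupleP; exists `|a| => g; case: ifPn => [/set_mem Pg|_].
  by have [hom _ _] := sys; apply: star_hom_le; exact: hom.
by rewrite normr0.
Qed.

Definition tuple_iota a : linf G A := Linf (tuple_iota_bounded a).

Fact tuple_shift_bounded (g : G) (x : linf G A) :
  (fun h => x (h + g)) \in @bounded_tuple R G A.
Proof. by have [M xM] := linfP x; apply/bounded_tupleP; exists M. Qed.

Definition tuple_shift g x : linf G A := Linf (tuple_shift_bounded g x).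

Definition prod_dilation_sub : cstarSub (linf G A) :=
  cstar_gen_sub (\bigcup_g (tuple_shift g @` range tuple_iota)).

Lemma tuple_shift_continuous g : continuous (tuple_shift g).
Proof.
apply: nonexpansive_continuous => x y.
by apply: linf_norm_le => // h; exact: linf_norm_ub (x - y) (h + g).
Qed.

Lemma tuple_shift_sub g x : cstarSub_set prod_dilation_sub x ->
  cstarSub_set prod_dilation_sub (tuple_shift g x).
Proof.
move=> Bx D DS; have [[D0 Dl DM Dst cD] SD] := DS.
apply: (Bx (tuple_shift g @^-1` D)); split.
  split=> /=.
  - by rewrite (_ : tuple_shift g 0 = 0)//; exact: linfE.
  - move=> k y z Dy Dz.
    rewrite (_ : tuple_shift g _ = k *: tuple_shift g y + tuple_shift g z).
      exact: Dl.
    exact: linfE.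
  - move=> y z Dy Dz.
    rewrite (_ : tuple_shift g _ = tuple_shift g y ** tuple_shift g z).
      exact: DM.
    exact: linfE.
  - move=> y Dy; rewrite (_ : tuple_shift g _ = star (tuple_shift g y)).
      exact: Dst.
    exact: linfE.
  - by apply: preimage_closed => // y _; exact: tuple_shift_continuous.
move=> _ [h _ [_ [a _ <-] <-]]; apply: SD; exists (g + h) => //.
exists (tuple_iota a); first by exists a.
by apply: linfE => k /=; rewrite addrA.
Qed.

Lemma tuple_iota_sub a : cstarSub_set prod_dilation_sub (tuple_iota a).
Proof.
move=> D [_ SD]; apply: SD; exists 0 => //; exists (tuple_iota a).
  by exists a.
by apply: linfE => h /=; rewrite addr0.
Qed.

Definition prod_dilation : cstarType R := cstar_sub prod_dilation_sub.

Definition prod_iota (a : A) : prod_dilation := CStarSubIn (tuple_iota_sub a).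

Definition prod_beta (g : G) (x : prod_dilation) : prod_dilation :=
  CStarSubIn (tuple_shift_sub g (cstar_subP x)).

End ProductDilation.
End Dynamics.

Arguments prod_iota {R G A P alpha} sys a.
Arguments prod_beta {R G A P alpha} sys g x.

(* Main.v *)
Require Import Defs.
From mathcomp Require Import all_boot all_order all_algebra.
From mathcomp Require Import complex boolp classical_sets reals.
From mathcomp Require Import topology normedtype.

Set Implicit Arguments.
Unset Strict Implicit.
Unset Printing Implicit Defensive.

Import GRing.Theory numFieldNormedType.Exports.

Local Open Scope classical_set_scope.
Local Open Scope ring_scope.

(** Everything takes place coordinatewise. At the coordinate [k], the product
    of the [g]-translate of the tuple of [a] and the [h]-translate of the tuple
    of [b] is [alpha_(k+g) a ** alpha_(k+h) b] when both [k + g] and [k + h]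
    lie in the cone [P], and zero otherwise. In the lattice order, [k + g] and
    [k + h] lie in [P] exactly when [- k] is a lower bound of [g] and [h],
    that is when [- k <= g /\ h], that is when [k + g /\ h] lies in [P]; in
    that case [alpha_(k + g /\ h)] factors out of both terms. This is Nica
    covariance ([prod_beta_iotaM]). The dilation identity is the same
    computation for the pair [0 <= p], whose greatest lower bound is [0].

    Injectivity of the embedding is seen at the coordinate [0], and the
    translations form an action by *-automorphisms because the operations of
    the product are coordinatewise. Minimality has one point to check: the
    algebra is generated by the translates inside the full product, whereas
    minimality concerns generation inside the subalgebra itself. The two agree
    because a C*-subalgebra of a C*-subalgebra is closed in the whole algebra
    ([cstar_subalgebra_image]). *)

(** * C*-subalgebras of a C*-subalgebra *)

(** Closedness is the only axiom that does not transfer at once: a limit point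
    of the image lies in [D], because [D] is closed, and its preimage is then a
    limit point of [E], because the inclusion is isometric. *)
Lemma cstar_subalgebra_image (R : realType) (A : cstarType R) (D : cstarSub A)
    (E : set (cstar_sub D)) :
  cstar_subalgebra E -> cstar_subalgebra (@cstar_val R A D @` E).
Proof.
move=> [E0 El EM Est cE]; split.
- by exists 0.
- by move=> k _ _ [x Ex <-] [y Ey <-]; exists (k *: x + y) => //; exact: El.
- by move=> _ _ [x Ex <-] [y Ey <-]; exists (x ** y) => //; exact: EM.
- by move=> _ [x Ex <-]; exists (star x) => //; exact: Est.
move=> l El'; have [_ _ _ _ cD] := cstarSubP D.
have Dl : cstarSub_set D l.
  apply: cD => U /El'[_ [[x _ <-] Ux]].
  by exists (cstar_val x); split=> //; exact: cstar_subP.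
exists (CStarSubIn Dl) => //; apply: cE => U /nbhs_ballP[e e0 eU].
have [_ [[x Ex <-] lx]] := El' _ (nbhsx_ballx l e e0).
by exists x; split=> //; apply: eU; move: lx; rewrite -!ball_normE.
Qed.

Lemma cstar_gen_in_sub (R : realType) (A : cstarType R) (S : set A)
    (T : set (cstar_sub (cstar_gen_sub S))) :
  S `<=` @cstar_val _ _ (cstar_gen_sub S) @` T -> [set: _] = cstar_gen T.
Proof.
move=> ST; apply/esym/seteqP; split=> // x _ E [subE TE].
have [|y Ey /val_inj <-//] :=
  cstar_subP x (@cstar_val _ _ (cstar_gen_sub S) @` E).
split; first exact: cstar_subalgebra_image.
by move=> z /ST[y Ty <-]; exists y => //; exact: TE.
Qed.

(** * The product dilation *)

Section ProductDilation.
Context (R : realType) (G : zmodType) (P : set G) (A : cstarType R).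
Context (alpha : G -> A -> A) (sys : dynamical_system P alpha).
Implicit Types (g h m p : G) (a b : A).

Lemma prod_dilationE (x y : prod_dilation sys) :
  (forall k, cstar_val x k = cstar_val y k) -> x = y.
Proof. by move=> xy; apply: val_inj; exact: linfE. Qed.

Lemma prod_beta_system : dynamical_system [set: G] (prod_beta sys).
Proof.
split=> [g _|x|g h _ _ x]; last 2 first.
- by apply: prod_dilationE => k /=; rewrite addr0.
- by apply: prod_dilationE => k /=; rewrite addrA.
by split=> *; exact: prod_dilationE.
Qed.

Lemma prod_iota_star_hom : star_hom (prod_iota sys).
Proof.
have [hom _ _] := sys.
split=> [c a b|a b|a]; apply: prod_dilationE => k.
- rewrite -[RHS]/(c *: tuple_iota sys a k + tuple_iota sys b k) /=.
  by case: ifPn => [/set_mem/hom[]//|_]; rewrite scaler0 addr0.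
- by rewrite /=; case: ifPn => [/set_mem/hom[]//|_]; rewrite cmul0l.
- by rewrite /=; case: ifPn => [/set_mem/hom[]//|_]; rewrite star0.
Qed.

Lemma prod_iota_inj : P 0 -> injective (prod_iota sys).
Proof.
move=> P0 a b /(congr1 (fun x : prod_dilation sys => linf_fun (cstar_val x) 0)) /=.
by have [_ alpha0 _] := sys; rewrite mem_set// !alpha0.
Qed.

(** The hypotheses on [m] say that it is the greatest lower bound of [g] and
    [h], with lower bounds written as [- k]. In this form they apply to [meet]
    and, without identifying [meet 0 p], to [0 <= p]. *)
Lemma prod_beta_iotaM g h m :
    (forall p q, P p -> P q -> P (p + q)) -> P (g - m) -> P (h - m) ->
    (forall k, P (k + g) -> P (k + h) -> P (k + m)) ->
  forall a b, prod_beta sys g (prod_iota sys a) **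
      prod_beta sys h (prod_iota sys b) =
    prod_beta sys m (prod_iota sys (alpha (g - m) a ** alpha (h - m) b)).
Proof.
move=> PD Pg Ph glb a b; have [hom _ alphaD] := sys.
have split_at k n : k + n = k + m + (n - m) by rewrite addrCA addrK addrC.
apply: prod_dilationE => k /=.
have [/set_mem Pm|Pm] := boolP (k + m \in P).
  have [_ mul _] := hom _ Pm.
  by rewrite mul -!alphaD// -!split_at !mem_set// split_at; exact: PD.
have [/set_mem Pkg|_] := boolP (k + g \in P); last by rewrite cmul0l.
have [/set_mem Pkh|_] := boolP (k + h \in P); last by rewrite cmul0r.
by case/negP: Pm; apply/mem_set/glb.
Qed.

Lemma prod_dilation_minimal :
  minimal_dilation (prod_beta sys) (prod_iota sys).
Proof.
apply: cstar_gen_in_sub => _ [g _ [_ [a _ <-] <-]].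
exists (prod_beta sys g (prod_iota sys a)) => //.
by exists g => //; exists (prod_iota sys a) => //; exists a.
Qed.

End ProductDilation.

Theorem proposition3p5 (R : realType) (G : zmodType) (P : set G)
    (join meet : G -> G -> G) (hP : lattice_ordered_group P join meet)
    (A : cstarType R) (alpha : G -> A -> A) (sys : dynamical_system P alpha) :
  [/\ automorphic_dilation P alpha (prod_beta sys) (prod_iota sys),
      nica_covariant alpha (prod_beta sys) (prod_iota sys) meet
    & minimal_dilation (prod_beta sys) (prod_iota sys)].
Proof.
have PD := coneD hP; have [_ alpha0 _] := sys.
have [_ beta0 _] := prod_beta_system sys.
split; last exact: prod_dilation_minimal.
- split.
  + exact: prod_beta_system.
  + exact: prod_iota_star_hom.
  + exact: prod_iota_inj (cone0 hP).
  + move=> a b p Pp.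
    rewrite -[prod_iota sys a]beta0 (prod_beta_iotaM sys (m := 0)) //.
    * by rewrite !subr0 alpha0 beta0.
    * by rewrite subr0; exact: cone0 hP.
    * by rewrite subr0.
- move=> a b g h; have [mg mh glb] := cone_meet hP g h.
  apply: prod_beta_iotaM => // k Pg Ph.
  by have := glb (- k); rewrite /cone_le opprK !(addrC _ k); exact.
Qed.
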